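(* Fix $r\in(0,\infty)$ and $b\in(0,1]$. For $\eta\in(0,1)$ let $\lambda=\lambda(\eta)=\sqrt{2\log\eta^{-v}}$, and let $N_{\theta,v}$, $D_\theta$ be the functions associated with the discrete sparse prior $\pi_{\mathsf D}[\eta;b,r]$, and $Z\sim N(0,1)$. As $\eta\to0$ (equivalently $\lambda\to\infty$), uniformly in $\theta=\lambda(\alpha_l+\omega)\ge\lambda$ (with integer $l\ge1$ and $\omega\in[0,\dot\alpha_l)$), we have $$\mathbb E\log N_{\theta,v}(Z)\ \ge\ \tfrac12\lambda^2\max\{n(l,\omega),\check n(l,\omega)\}+O(1),$$ $$\mathbb E\log D_\theta(Z)\ \le\ \tfrac12\lambda^2\max\{d(l,\omega),0\}+O(\lambda).$$ For $0\le\theta<\lambda$ we have $\mathbb E\log N_{\theta,v}(Z)\ge0$ and $\mathbb E\log D_\theta(Z)\le O(\lambda)$.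
   Context: Let $v=(1+r^{-1})^{-1}$ and $K=1+\lceil2b^{-3/2}\rceil$. For integers $j\ge1$ define $$\alpha_j=\begin{cases}1+b(j-1)&1\le j\le K\\ \alpha_K+j-K&j>K\end{cases},\qquad \beta_j=\begin{cases}1+b^2(j-1)&1\le j\le K\\ \beta_K+j-K&j>K\end{cases},$$ and $\dot\alpha_j=\alpha_{j+1}-\alpha_j$. The prior is $\pi_{\mathsf D}[\eta;b,r]=\sum_{j\in\mathbb Z}\pi_j\delta_{\mu_j}$ (with $\delta_a$ the unit point mass at $a$), where $\mu_0=0$, $\mu_j=\lambda\alpha_j$ for $j\ge1$, $\mu_{-j}=-\mu_j$, $\pi_{-j}=\pi_j$, $\pi_0=1-\eta$, and $\pi_j=c(\eta)\,\eta\,(\eta^v)^{\beta_j-1}$ for $j\ge1$, with normalizing constant $c(\eta)$ given by $$\frac1{2c(\eta)}=\frac{1-\eta^{b^2vK}}{1-\eta^{b^2v}}+\frac{\eta^{b^2v(K-1)+v}}{1-\eta^v},$$ so that the total mass is $1$. For $\theta\in\mathbb R$ and $z\in\mathbb R$, $$N_{\theta,v}(z)=1+\sum_{j\ne0}\frac{\pi_j}{\pi_0}\exp\Bigl\{\frac{\mu_jz}{\sqrt v}+\frac{1}{v}\Bigl(\mu_j\theta-\tfrac12\mu_j^2\Bigr)\Bigr\},\qquad D_\theta(z)=1+\sum_{j\ne0}\frac{\pi_j}{\pi_0}\exp\bigl\{\mu_jz+\mu_j\theta-\tfrac12\mu_j^2\bigr\}.$$ Every $\theta\ge\lambda$ is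 written uniquely as $\theta=\lambda(\alpha_l+\omega)$ with integer $l\ge1$ and $\omega\in[0,\dot\alpha_l)$. Define $$n(l,\omega)=v^{-1}(\alpha_l^2+2\alpha_l\omega)-\beta_l-r^{-1},\qquad d(l,\omega)=\alpha_l^2+2\alpha_l\omega-\beta_l-r^{-1},$$ $$\check n(l,\omega)=n(l,\omega)+2v^{-1}\dot\alpha_l\omega-(1+v^{-1})\dot\alpha_l^2.$$ The implied constants in $O(1)$ and $O(\lambda)$ may depend on $r$ and $b$ but not on $\theta$. *)

(* Defs.v *)
From HB Require Import structures.
From mathcomp Require Import all_boot all_order all_algebra.
From mathcomp Require Import all_classical all_reals all_analysis.

Set Implicit Arguments.
Unset Strict Implicit.
Unset Printing Implicit Defensive.

Import Order.TTheory GRing.Theory Num.Theory.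
Import numFieldNormedType.Exports.

Local Open Scope classical_set_scope.
Local Open Scope ring_scope.

Definition vpar {R : realType} (r : R) : R := (1 + r^-1)^-1.

Definition lambda {R : realType} (r eta : R) : R :=
  Num.sqrt (2 * ln (eta `^ (- vpar r))).

(* The ceiling is nonnegative for b > 0, so [absz] is just the cast to nat. *)
Definition Kpar {R : realType} (b : R) : nat :=
  (1 + `|Num.ceil (2 * b `^ (- (3 / 2)))|)%N.

(* [alpha], [beta], [dalpha] and the exponents below are meaningful only for
   indices >= 1. *)
Definition alpha {R : realType} (b : R) (j : nat) : R :=
  if (j <= Kpar b)%N then 1 + b * (j%:R - 1)
  else (1 + b * ((Kpar b)%:R - 1)) + j%:R - (Kpar b)%:R.

Definition beta {R : realType} (b : R) (j : nat) : R :=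
  if (j <= Kpar b)%N then 1 + b ^+ 2 * (j%:R - 1)
  else (1 + b ^+ 2 * ((Kpar b)%:R - 1)) + j%:R - (Kpar b)%:R.

Definition dalpha {R : realType} (b : R) (j : nat) : R :=
  alpha b j.+1 - alpha b j.

Definition cnorm {R : realType} (r b eta : R) : R :=
  let v := vpar r in
  let K : R := (Kpar b)%:R in
  (2 * ((1 - eta `^ (b ^+ 2 * v * K)) / (1 - eta `^ (b ^+ 2 * v))
        + eta `^ (b ^+ 2 * v * (K - 1) + v) / (1 - eta `^ v)))^-1.

(* The discrete sparse prior puts mass [weight r b eta j] at [atom r b eta j],
   for j ranging over the integers; sgz 0 = 0 places the atom j = 0 at 0. *)
Definition atom {R : realType} (r b eta : R) (j : int) : R :=
  (sgz j)%:~R * (lambda r eta * alpha b `|j|%N).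

Definition weight {R : realType} (r b eta : R) (j : int) : R :=
  if j == 0 then 1 - eta
  else cnorm r b eta * eta * (eta `^ vpar r) `^ (beta b `|j|%N - 1).

Definition Nterm {R : realType} (r b eta theta z : R) (j : int) : R :=
  weight r b eta j / weight r b eta 0 *
  expR (atom r b eta j * z / Num.sqrt (vpar r) +
        (vpar r)^-1 * (atom r b eta j * theta - 2^-1 * atom r b eta j ^+ 2)).

Definition Dterm {R : realType} (r b eta theta z : R) (j : int) : R :=
  weight r b eta j / weight r b eta 0 *
  expR (atom r b eta j * z + atom r b eta j * theta
        - 2^-1 * atom r b eta j ^+ 2).

(* All terms are nonnegative, so the series over j <> 0 are unordered sums in
   the extended reals. *)
Definition Nfun {R : realType} (r b eta theta z : R) : \bar R :=
  (1 + \esum_(j in [set j : int | (j != 0)%R])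
         (Nterm r b eta theta z j)%:E)%E.

Definition Dfun {R : realType} (r b eta theta z : R) : \bar R :=
  (1 + \esum_(j in [set j : int | (j != 0)%R])
         (Dterm r b eta theta z j)%:E)%E.

(* E log F(Z) for Z ~ N(0,1). *)
Definition Elog {R : realType} (F : R -> \bar R) : \bar R :=
  (\int[normal_prob (0 : R) (1 : R)]_z lne (F z))%E.

Definition nexp {R : realType} (r b : R) (l : nat) (omega : R) : R :=
  (vpar r)^-1 * (alpha b l ^+ 2 + 2 * alpha b l * omega) - beta b l - r^-1.

Definition dexp {R : realType} (r b : R) (l : nat) (omega : R) : R :=
  alpha b l ^+ 2 + 2 * alpha b l * omega - beta b l - r^-1.

Definition ncheck {R : realType} (r b : R) (l : nat) (omega : R) : R :=
  nexp r b l omega + 2 * (vpar r)^-1 * dalpha b l * omega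
  - (1 + (vpar r)^-1) * dalpha b l ^+ 2.

(* Main.v *)
(** With [q = lambda ^ 2 / 2] the j-th prior weight is, up to a bounded factor,
    [expR (- q (beta_j + 1/r))], so for [theta = lambda t] the j-th term (j > 0)
    at [z = 0] is [expR (q (parabola t j - 1/r))] in D, and similarly in N.
    The lower bound for N keeps the single term [j = l], resp. [j = l + 1]: its
    logarithm is affine in [z]. For D, since the increments of [beta] are the
    squares of those of [alpha], [parabola t] peaks exactly at [j = l] and decays
    quadratically in [|j - l|]; hence the positive part of the series is at most a
    geometric series times [expR (s z + m + O(lambda |z| + z ^ 2))], with
    [s = lambda alpha_l] and [m = q d], and the negative part is
    [O (expR (z ^ 2 / 2))]. Only [E max(0, s Z + m)] remains: it is
    [max(m, 0) + O(lambda)] because either [alpha_l] is bounded, or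
    [s ^ 2 <= 16 m] and then [max(0, s z + m) <= m + s z + 4 z ^ 2]. *)

Require Import Defs.
From HB Require Import structures.
From mathcomp Require Import all_boot all_order all_algebra finmap.
From mathcomp Require Import all_classical all_reals all_analysis.
From mathcomp Require Import measurable_realfun zify ring lra.

Import Order.TTheory GRing.Theory Num.Theory.
Import numFieldNormedType.Exports.

Local Open Scope classical_set_scope.
Local Open Scope ring_scope.

(** * Integrals of nonnegative functions against the normal law *)

Section Integral.
Local Open Scope ereal_scope.
Import HBNNSimple.

(** The integral of a nonnegative function is the supremum over the simple functions below it, and
    these become more numerous as the function grows. This serves for [lne] of the series, whose
    measurability is never established. *)
Lemma ge0_le_integral_nonmeasurable d (T : measurableType d) (R : realType)
    (mu : {measure set T -> \bar R}) (f g : T -> \bar R) :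
  (forall x, 0 <= f x) -> (forall x, f x <= g x) ->
  \int[mu]_x f x <= \int[mu]_x g x.
Proof.
move=> f0 fg; have g0 x : 0 <= g x by exact: le_trans (f0 x) (fg x).
rewrite !ge0_integralTE//; apply: ereal_sup_le => _ [h hf <-].
by exists h => // x; exact: le_trans (hf x) (fg x).
Qed.

(** On each level set, the measure is by definition the integral of the density; the finite sum over
    values is then exchanged with the integral. *)
Lemma sintegral_normal_prob {R : realType} (m s : R) 
    (h : {nnsfun measurableTypeR R >-> R}) :
  sintegral (normal_prob m s) h =
  \int[lebesgue_measure]_x ((h x)%:E * (normal_pdf m s x)%:E).
Proof.
rewrite sintegralE.
under [RHS]eq_integral.
  move=> x _; rewrite fimfunE -fsumEFin// ge0_mule_fsuml; last first.
    by move=> y; rewrite EFinM nnfun_muleindic_ge0.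
  over.
rewrite /= ge0_integral_fsum//; last 2 first.
- move=> y; apply/measurable_EFinP/measurable_funM;
    last exact: measurable_normal_pdf.
  apply: measurable_funM => //; apply: measurable_indic; exact: measurable_funPTI.
- by move=> y x _; rewrite mule_ge0// ?nnfun_muleindic_ge0// lee_fin normal_pdf_ge0.
apply: eq_fsbigr => y _.
rewrite /normal_prob.
have [y0|y0] := leP 0%R y; last first.
  rewrite preimage_nnfun0// integral_set0 mule0; apply/esym/integral0_eq => x _.
  by rewrite indic0 mulr0 mul0e.
under [RHS]eq_integral do rewrite EFinM -muleA.
rewrite ge0_integralZl//=; last 2 first.
- apply: emeasurable_funM; apply/measurable_EFinP.
    by apply: measurable_indic; exact: measurable_funPTI.
  exact: measurable_normal_pdf.
- by move=> x _; rewrite mule_ge0// lee_fin ?normal_pdf_ge0.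
congr (_ * _); rewrite integral_mkcond; apply: eq_integral => x _.
by rewrite patchE indicE; case: ifP; rewrite ?mul1e ?mul0e.
Qed.

(** Each simple function below [f] already satisfies the bound. The one inequality is enough for the
    moment bounds below. *)
Lemma integral_normal_prob_le_pdf {R : realType} (m s : R) (f : R -> \bar R) :
  (forall x, 0 <= f x) ->
  \int[normal_prob m s]_x f x <=
  \int[lebesgue_measure]_x (f x * (normal_pdf m s x)%:E).
Proof.
move=> f0; rewrite [leLHS]ge0_integralTE//; apply: ge_ereal_sup => _ [h hf <-].
rewrite [leLHS](sintegral_normal_prob m s h).
apply: ge0_le_integral_nonmeasurable => x.
  by rewrite mule_ge0// lee_fin ?normal_pdf_ge0.
by rewrite lee_wpmul2r// lee_fin normal_pdf_ge0.
Qed.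

(** Completing the square turns the tilted standard density into [expR (t ^+ 2 / 2)] times the
    density centred at [t]. *)
Lemma normal_mgf_le {R : realType} (t : R) :
  \int[normal_prob (0 : R) 1]_x (expR (t * x))%:E <= (expR (t ^+ 2 / 2))%:E.
Proof.
apply: le_trans (integral_normal_prob_le_pdf _ _ _ _) _.
  by move=> x; rewrite lee_fin expR_ge0.
have shift x : (expR (t * x))%:E * (normal_pdf 0 1 x)%:E =
    (expR (t ^+ 2 / 2))%:E * (normal_pdf t 1 x)%:E.
  rewrite -!EFinM !normal_pdfE ?oner_eq0// /normal_fun; congr EFin.
  rewrite mulrCA [RHS]mulrCA -!expRD; congr (_ * expR _)%R.
  by field.
under eq_integral do rewrite shift.
rewrite ge0_integralZl//; last 2 first.
- by apply/measurable_EFinP; exact: measurable_normal_pdf.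
- by move=> x _; rewrite lee_fin normal_pdf_ge0.
by rewrite integral_normal_pdf mule1.
Qed.

End Integral.

(** * First and second Gaussian moments, with affine and quadratic comparison *)

Section GaussianMoments.
Context {R : realType}.
Notation P := (normal_prob (0 : R) 1).
Local Open Scope ereal_scope.

(** Comes from x^2 <= 2 e^x + 2 e^(-x), where each exponential has mean at most e^(1/2). *)
Definition second_moment_bound : R := (4 * expR (2^-1))%R.

Lemma sqr_le_expRD (x : R) : (x ^+ 2 <= 2 * expR (1 * x) + 2 * expR (-1 * x))%R.
Proof.
wlog x0 : x / (0 <= x)%R => [H|].
  have [/H//|/ltW x0] := leP 0%R x; have := H (- x)%R.
  by rewrite oppr_ge0 sqrrN !mulrN !mulNr !mul1r opprK addrC; exact.
have := expR_ge1Dxn 1 x0; have := expR_gt0 (-1 * x); rewrite mul1r.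
have -> : (2`!%:R = 2 :> R)%R by [].
by lra.
Qed.

Lemma normal_second_moment_le :
  \int[P]_x (x ^+ 2)%:E <= second_moment_bound%:E.
Proof.
have me (t : R) : measurable_fun setT (fun x : R => (2 * expR (t * x))%:E).
  apply/measurable_EFinP/measurable_funM => //.
  by apply: measurableT_comp => //; exact: measurable_funM.
apply: (@le_trans _ _ (\int[P]_x
    ((2 * expR (1 * x))%:E + (2 * expR (-1 * x))%:E))).
  apply: ge0_le_integral_nonmeasurable => x; first by rewrite lee_fin sqr_ge0.
  by rewrite -EFinD lee_fin sqr_le_expRD.
have ge (t : R) : \int[P]_x (2 * expR (t * x))%:E <= (2 * expR (t ^+ 2 / 2))%:E.
  under eq_integral do rewrite EFinM.
  rewrite ge0_integralZl//; last first.
    apply/measurable_EFinP/measurableT_comp => //; exact: measurable_funM.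
  by rewrite EFinM lee_wpmul2l// ?lee_fin// normal_mgf_le.
rewrite ge0_integralD//; [|exact: me|exact: me].
apply: le_trans (leeD (ge 1%R) (ge (-1)%R)) _.
rewrite -EFinD lee_fin sqrrN expr1n /second_moment_bound mul1r; lra.
Qed.

Lemma integrable_normal_sqr : P.-integrable setT (fun x => (x ^+ 2)%:E).
Proof.
apply/integrableP; split; first exact/measurable_EFinP/measurable_funX.
under eq_integral do rewrite gee0_abs ?lee_fin ?sqr_ge0//.
by apply: le_lt_trans normal_second_moment_le _; rewrite ltry.
Qed.

Lemma integrable_normal_id : P.-integrable setT (fun x => x%:E).
Proof.
apply: (@le_integrable _ _ _ P _ _ _ (fun x => 1%:E + (x ^+ 2)%:E)) => //.
- exact/measurable_EFinP.
- move=> x _; rewrite -EFinD !abse_EFin lee_fin [leRHS]ger0_norm; last first.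
    by have := sqr_ge0 x; lra.
  have := sqr_ge0 (`|x| - 1)%R; have := sqr_ge0 x.
  by rewrite sqrrB -normrX (ger0_norm (sqr_ge0 x)) mulr1; lra.
- apply: integrableD => //; last exact: integrable_normal_sqr.
  exact: finite_measure_integrable_cst.
Qed.

(* [1 + t E Z <= E exp(t Z) <= exp(t ^ 2 / 2)] for all [t] forces [E Z = 0]. *)
Lemma normal_mean : \int[P]_x x%:E = 0.
Proof.
have fin := integrable_fin_num measurableT integrable_normal_id.
rewrite -(fineK fin); set m := fine _; congr EFin.
have tangent (t : R) : (1 + t * m <= expR (t ^+ 2 / 2))%R.
  rewrite -lee_fin; apply: le_trans (normal_mgf_le t).
  have -> : (1 + t * m)%:E = \int[P]_x (1%:E + t%:E * x%:E).
    rewrite integralD//; last 2 first.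
    - exact: finite_measure_integrable_cst.
    - exact/integrableZl/integrable_normal_id.
    rewrite integral_cst//= integralZl//; last exact: integrable_normal_id.
    by rewrite [X in _ * X]probability_setT mul1e /m EFinD EFinM fineK.
  apply: le_integral => //.
  - apply: integrableD => //; first exact: finite_measure_integrable_cst.
    exact/integrableZl/integrable_normal_id.
  - apply/integrableP; split.
      by apply/measurable_EFinP/measurableT_comp => //; exact: measurable_funM.
    under eq_integral do rewrite gee0_abs ?lee_fin ?expR_ge0//.
    by apply: le_lt_trans (normal_mgf_le t) _; rewrite ltry.
  - by move=> x _; rewrite -EFinM -EFinD lee_fin expR_ge1Dx.
(* With s = t^2/2 <= 1/2, the bound e^s <= 1/(1 - s) <= 1 + 2s turns [tangent] into a quadratic
   estimate. *)
have small (t : R) : (t ^+ 2 <= 1 -> t * m <= t ^+ 2)%R.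
  move=> t1; have := tangent t; have := expR_ge1Dx (- (t ^+ 2 / 2)).
  rewrite expRN => h1 h2; have := expR_gt0 (t ^+ 2 / 2); move: h1 h2.
  set e := expR _ => h1 h2 e0.
  have : ((1 - t ^+ 2 / 2) * e <= 1)%R by rewrite -ler_pdivlMr// mul1r.
  by have := sqr_ge0 t; nra.
apply/eqP/negPn/negP => m0.
(* If |m| <= 1, taking t = m/2 gives m^2/2 <= m^2/4; otherwise t = 1 or t = -1, by the sign of m,
   gives |m| <= 1. *)
have [M|M] := leP (m ^+ 2)%R 1%R.
- have := small (m / 2)%R; have := sqr_ge0 m.
  have : (m ^+ 2 != 0)%R by rewrite sqrf_eq0.
  rewrite neq_lt => /orP[|] ? ? h; first lra.
  by have := h ltac:(nra); nra.
- have [m_gt0|m_le0] := ltP 0%R m.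
    by have := small 1%R; rewrite expr1n mul1r => /(_ (lexx _)); nra.
  by have := small (-1)%R; rewrite sqrrN expr1n mulN1r => /(_ (lexx _)); nra.
Qed.

(** The linear part has mean zero. Since [f] is nonnegative it dominates the positive part of the
    affine function, so only nonnegative functions are compared. *)
Lemma affine_le_integral_normal (f : R -> \bar R) (a s : R) :
  (forall x, 0 <= f x) -> (forall x, (a + s * x)%:E <= f x) ->
  a%:E <= \int[P]_x f x.
Proof.
move=> f0 af.
have ia : P.-integrable setT (fun x => a%:E + s%:E * x%:E).
  apply: integrableD => //; first exact: finite_measure_integrable_cst.
  exact/integrableZl/integrable_normal_id.
have {1}-> : a%:E = \int[P]_x (a%:E + s%:E * x%:E).
  rewrite integralD//; last 2 first.
  - exact: finite_measure_integrable_cst.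
  - exact/integrableZl/integrable_normal_id.
  rewrite integral_cst//= integralZl//; last exact: integrable_normal_id.
  by rewrite normal_mean [X in _ * X]probability_setT mule1 mule0 adde0.
rewrite integralE; apply: (@le_trans _ _
    (\int[P]_x (fun x => a%:E + s%:E * x%:E)^\+ x)).
  by rewrite geeDl// oppe_le0; apply: integral_ge0 => x _; exact: funeneg_ge0.
apply: ge0_le_integral_nonmeasurable => x; first exact: funepos_ge0.
by rewrite funeposE ge_max f0 andbT -EFinM -EFinD.
Qed.

(** The slope [s] vanishes from the bound, so slopes as large as lambda alpha_l cost nothing; only
    [c] must be kept of order lambda. *)
Lemma integral_normal_le_quadratic (f : R -> \bar R) (a s c : R) : (0 <= c)%R ->
  (forall x, 0 <= f x) -> (forall x, f x <= (a + s * x + c * x ^+ 2)%:E) ->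
  \int[P]_x f x <= (a + c * second_moment_bound)%:E.
Proof.
move=> c0 f0 fa; apply: (le_trans (ge0_le_integral_nonmeasurable _ _ _ P _ _ f0 fa)).
under eq_integral do rewrite EFinD EFinD !EFinM.
rewrite integralD//; last 2 first.
- apply: integrableD => //; first exact: finite_measure_integrable_cst.
  exact/integrableZl/integrable_normal_id.
- exact/integrableZl/integrable_normal_sqr.
rewrite integralD//; last 2 first.
- exact: finite_measure_integrable_cst.
- exact/integrableZl/integrable_normal_id.
rewrite integral_cst//= !integralZl//; last 2 first.
- exact: integrable_normal_sqr.
- exact: integrable_normal_id.
rewrite normal_mean [X in _ * X + _]probability_setT mule1 mule0 adde0 EFinD EFinM.
by rewrite leeD2l// lee_wpmul2l// ?lee_fin// normal_second_moment_le.
Qed.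

End GaussianMoments.

(** * Unordered sums over the integers with geometric decay *)

Section Series.
Context {R : realType}.

Lemma expRN_natr_le (k : nat) : expR (- k%:R) <= 2^-1 ^+ k :> R.
Proof.
have half : expR (- 1) <= 2^-1 :> R.
  rewrite expRN lef_pV2 ?posrE ?expR_gt0//.
  by apply: le_trans (expR_ge1Dx 1); lra.
by rewrite -[k%:R]mulr1 -mulrN expRM_natl lerXn2r// nnegrE ?expR_ge0.
Qed.

Lemma count_dist_le2 (s : seq int) (l : int) (k : nat) : uniq s ->
  (count (fun j => `|j - l|%N == k) s <= 2)%N.
Proof.
move=> us; rewrite -size_filter.
apply: (@uniq_leq_size _ _ [:: l + k%:Z; l - k%:Z]); first exact: filter_uniq.
by move=> j; rewrite mem_filter !inE => /andP[/eqP jk _]; apply/orP; lia.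
Qed.

(** Group by the distance k to [l]: at most two integers lie at each distance, and the sum of 2 *
    2^(-k) stays below 4. *)
Lemma sum_expRN_dist_le (s : seq int) (l : int) : uniq s ->
  \sum_(j <- s) expR (- (`|j - l|%N)%:R) <= 4 :> R.
Proof.
move=> us; pose N := (\max_(j <- s) `|j - l|).+1%N.
apply: (@le_trans _ _ (\sum_(j <- s) \sum_(k < N | `|j - l|%N == k) 2^-1 ^+ k)).
  rewrite big_seq [leRHS]big_seq; apply: ler_sum => j js.
  have jN : (`|j - l| < N)%N by rewrite ltnS; apply: leq_bigmax_seq.
  rewrite (bigD1 (Ordinal jN))//= big1 ?addr0 ?expRN_natr_le// => i /andP[/eqP ji].
  by move=> /negP[]; apply/eqP/val_inj.
rewrite (exchange_big_dep xpredT)//=.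
apply: (@le_trans _ _ (\sum_(k < N) 2 * 2^-1 ^+ k)).
  apply: ler_sum => k _; rewrite big_const_seq iter_addr_0 -[leLHS]mulr_natl.
  by rewrite ler_wpM2r ?exprn_ge0 ?invr_ge0// (ler_nat R _ 2) count_dist_le2.
have geo n : \sum_(k < n) 2 * 2^-1 ^+ k = 4 - 4 * 2^-1 ^+ n :> R.
  elim: n => [|n IH]; first by rewrite big_ord0 expr0; ring.
  by rewrite big_ord_recr/= IH exprS; field.
by rewrite geo gerBl mulr_ge0// exprn_ge0// invr_ge0.
Qed.

(** There are two centres of decay: 0 will serve the negative atoms, and [l] the positive ones. *)
Lemma esum_int_le (S : set int) (a : int -> R) (B1 B2 : R) (l : int) :
  0 <= B1 -> 0 <= B2 ->
  (forall j, S j ->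
    a j <= B1 * expR (- (`|j|%N)%:R) + B2 * expR (- (`|j - l|%N)%:R)) ->
  (\esum_(j in S) (a j)%:E <= (4 * B1 + 4 * B2)%:E)%E.
Proof.
move=> B10 B20 aB; apply: ge_ereal_sup => _ [A [finA AS] <-].
rewrite fsbig_finite//= sumEFin lee_fin.
set s := fset_set A; have us : uniq s by exact: fset_uniq.
apply: (@le_trans _ _ (\sum_(j <- s)
    (B1 * expR (- (`|j - 0|%N)%:R) + B2 * expR (- (`|j - l|%N)%:R)))).
  rewrite big_seq [leRHS]big_seq; apply: ler_sum => j.
  by rewrite subr0 in_fset_set// inE => /AS; exact: aB.
rewrite big_split/= -!mulr_sumr !(mulrC 4).
by rewrite lerD// ler_wpM2l// sum_expRN_dist_le.
Qed.

Lemma ler_esum_term (S : set int) (a : int -> \bar R) (j : int) :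
  S j -> (a j <= \esum_(i in S) a i)%E.
Proof.
move=> Sj; apply: esum_ge; exists [set j]; last by rewrite fsbig_set1.
by split; [exact: finite_set1 | move=> _ ->].
Qed.

End Series.

(** * Geometry of the sequences alpha and beta, and the peak of the exponent *)

Section Lattice.
Context {R : realType} (b : R) (hb0 : 0 < b) (hb1 : b <= 1).

(** The step that leaves index K already has unit length, so it falls in the second case. *)
Lemma alpha_beta_step i :
  (alpha b i.+1 = alpha b i + b /\ beta b i.+1 = beta b i + b ^+ 2) \/
  (alpha b i.+1 = alpha b i + 1 /\ beta b i.+1 = beta b i + 1).
Proof.
rewrite /alpha /beta -natr1; have [iK|Ki] := leqP i.+1 (Kpar b).
  by rewrite (ltnW iK); left; split; ring.
right; have [iK|_] := leqP i (Kpar b); last by split; ring.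
by have -> : i = Kpar b by [apply/eqP; rewrite eqn_leq iK -ltnS]; split; ring.
Qed.

Lemma dbetaE i : beta b i.+1 - beta b i = dalpha b i ^+ 2.
Proof. by rewrite /dalpha; have [] := alpha_beta_step i => -[-> ->]; ring. Qed.

Lemma dalpha_bounds i : b <= dalpha b i <= 1.
Proof.
have := hb1; rewrite /dalpha.
by have [] := alpha_beta_step i => -[-> _] ?; apply/andP; split; lra.
Qed.

Lemma alpha1 : alpha b 1 = 1. Proof. by rewrite /alpha /=; ring. Qed.

Lemma beta1 : beta b 1 = 1. Proof. by rewrite /beta /=; ring. Qed.

Lemma alpha_gap i k : b * k%:R <= alpha b (i + k) - alpha b i <= k%:R.
Proof.
elim: k => [|k /andP[IH1 IH2]]; first by rewrite addn0 subrr mulr0 lexx.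
have := dalpha_bounds (i + k); rewrite /dalpha addnS -natr1 => /andP[? ?].
by apply/andP; split; lra.
Qed.

Lemma alpha_ge1 i : (1 <= i)%N -> 1 <= alpha b i.
Proof.
case: i => // i _; have := alpha_gap 1 i; rewrite add1n alpha1 => /andP[h _].
by have := mulr_ge0 (ltW hb0) (ler0n R i); lra.
Qed.

(** Both sequences start at 1, and each increment d of alpha gives an increment d^2 of beta with b^2
    <= d^2 <= d. *)
Lemma beta_bounds i : (1 <= i)%N -> b ^+ 2 * i%:R <= beta b i <= alpha b i.
Proof.
case: i => // i _; elim: i => [|i /andP[IH1 IH2]].
  by rewrite alpha1 beta1 mulr1 lexx andbT expr_le1// ltW.
have b1 := hb1; have b0 := hb0; have b2 : b ^+ 2 <= b by rewrite expr2; nra.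
rewrite -natr1; have [] := alpha_beta_step i.+1 => -[-> ->]; apply/andP; split; nra.
Qed.

(** Equals t^2 - (t - alpha_j)^2 - beta_j; at j = l and t = alpha_l + omega it is [dexp] plus
    1/r. *)
Definition parabola (t : R) (j : nat) : R :=
  2 * alpha b j * t - alpha b j ^+ 2 - beta b j.

(** Since beta grows by the square of the increment of alpha, the change of sign occurs exactly when
    t crosses alpha_(i+1). *)
Lemma parabolaS t i :
  parabola t i.+1 = parabola t i + 2 * dalpha b i * (t - alpha b i.+1).
Proof. by rewrite /parabola; have := dbetaE i; rewrite /dalpha; nra. Qed.

(** The step from l + i to l + i + 1 loses at least 2 b^2 i, because alpha has then moved at least b
    i beyond t; summing over i < k gives b^2 k (k - 1). *)
Lemma parabola_right t l k : t <= alpha b l.+1 ->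
  parabola t (l + k) <= parabola t l - b ^+ 2 * (k%:R * (k%:R - 1)).
Proof.
move=> tl; elim: k => [|k IH]; first by rewrite addn0 mul0r mulr0 subr0.
rewrite addnS parabolaS -natr1; have /andP[d1 _] := dalpha_bounds (l + k).
have := alpha_gap l.+1 k; rewrite addSn => /andP[g _].
have k0 := ler0n R k; have h : t - alpha b (l + k).+1 <= - (b * k%:R) by lra.
have b0 := hb0; have bk : 0 <= b * k%:R by rewrite mulr_ge0// ltW.
by nra.
Qed.

Lemma parabola_left t i k : alpha b (i + k) <= t ->
  parabola t i <= parabola t (i + k) - b ^+ 2 * (k%:R * (k%:R - 1)).
Proof.
elim: k i => [|k IH] i; first by rewrite addn0 mul0r mulr0 subr0.
rewrite addnS -addSn => tl; have := IH _ tl; rewrite parabolaS -natr1.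
have /andP[d1 _] := dalpha_bounds i; have /andP[g _] := alpha_gap i.+1 k.
have k0 := ler0n R k; have h : b * k%:R <= t - alpha b i.+1 by lra.
have b0 := hb0; have bk : 0 <= b * k%:R by rewrite mulr_ge0// ltW.
by nra.
Qed.

Lemma parabola_peak t l j (k : R := (`|j%:Z - l%:Z|%N)%:R) :
  alpha b l <= t -> t <= alpha b l.+1 ->
  parabola t j <= parabola t l - b ^+ 2 * (k * (k - 1)) /\
  `|alpha b j - alpha b l| <= k.
Proof.
rewrite /k => lt tl; have [lj|/ltnW jl] := leqP l j.
- rewrite -(subnKC lj); set i := (j - l)%N.
  have -> : `|(l + i)%N%:Z - l%:Z|%N = i by lia.
  have /andP[g1 g2] := alpha_gap l i.
  have := mulr_ge0 (ltW hb0) (ler0n R i); split; first exact: parabola_right.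
  by rewrite ger0_norm//; lra.
- move: lt; rewrite -(subnKC jl); set i := (l - j)%N => lt.
  have -> : `|j%:Z - (j + i)%N%:Z|%N = i by lia.
  have /andP[g1 g2] := alpha_gap j i.
  have := mulr_ge0 (ltW hb0) (ler0n R i); split; first exact: parabola_left.
  by rewrite distrC ger0_norm//; lra.
Qed.

End Lattice.

(** * Size of the prior weights for small eta *)

Section Prior.
Context {R : realType} (r b : R) (hr : 0 < r) (hb0 : 0 < b) (hb1 : b <= 1).
Local Notation v := (vpar r).

Lemma vpar_gt0 : 0 < v.
Proof. by rewrite /vpar invr_gt0 addr_gt0// invr_gt0. Qed.

Lemma vparV : v^-1 = 1 + r^-1. Proof. by rewrite /vpar invrK. Qed.

Lemma powR_lnE (eta x : R) : 0 < eta -> eta `^ x = expR (x * ln eta).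
Proof. by move=> eta0; rewrite /powR gt_eqF. Qed.

Lemma powR_lt1 (eta x : R) : 0 < eta < 1 -> 0 < x -> eta `^ x < 1.
Proof.
move=> /andP[eta0 eta1] x0; rewrite powR_lnE// expR_lt1 pmulr_rlt0// ln_lt0//.
by rewrite eta0.
Qed.

Lemma lambda_sqr (eta : R) : 0 < eta < 1 -> lambda r eta ^+ 2 = - (2 * v * ln eta).
Proof.
move=> eta01; rewrite /lambda ln_powR sqr_sqrtr; first by ring.
by rewrite mulr_ge0// mulNr oppr_ge0 pmulr_rle0 ?vpar_gt0// ltW// ln_lt0.
Qed.

(** Here c = 1/(2Q). The first fraction of Q is at least 1, and both fractions are at most 2 once
    their denominators are at least 1/2, so 1 <= Q <= 4. *)
Lemma cnorm_bounds (eta : R) : 0 < eta < 1 -> 0 < cnorm r b eta <= 2^-1 /\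
  (eta `^ (b ^+ 2 * v) <= 2^-1 -> 8^-1 <= cnorm r b eta).
Proof.
move=> eta01; have /andP[eta0 eta1] := eta01; have v0 := vpar_gt0.
have b2 : 0 < b ^+ 2 by rewrite exprn_gt0.
have b2_le1 : b ^+ 2 <= 1 by rewrite expr_le1// ltW.
rewrite /cnorm /=; set K : R := (Kpar b)%:R.
have K1 : 1 <= K by rewrite (ler_nat R 1).
have b2v : 0 < b ^+ 2 * v by rewrite mulr_gt0.
have mono (x x' : R) : x <= x' -> eta `^ x' <= eta `^ x.
  by move=> xx'; rewrite !powR_lnE// ler_expR ler_wnM2r// ltW// ln_lt0.
have xy : eta `^ (b ^+ 2 * v * K) <= eta `^ (b ^+ 2 * v) by apply: mono; nra.
have ty : eta `^ v <= eta `^ (b ^+ 2 * v) by apply: mono; nra.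
have y1 := powR_lt1 _ _ eta01 b2v; have t1 := powR_lt1 _ _ eta01 v0.
have u1 : eta `^ (b ^+ 2 * v * (K - 1) + v) < 1 by apply: powR_lt1 => //; nra.
have x0 := powR_ge0 eta (b ^+ 2 * v * K).
have u0 := powR_ge0 eta (b ^+ 2 * v * (K - 1) + v).
move: xy ty y1 t1 u1 x0 u0.
set x := eta `^ (_ * K); set y := eta `^ (_ * v); set t := eta `^ v.
set u := eta `^ _ => xy ty y1 t1 u1 x0 u0.
set Q := (1 - x) / (1 - y) + _.
have Q1 : 1 <= Q.
  rewrite -[leLHS]addr0 lerD ?divr_ge0 ?subr_ge0 ?(ltW t1)//.
  by rewrite ler_pdivlMr ?subr_gt0// mul1r lerB.
split; first by rewrite invr_gt0 lef_pV2 ?posrE; [apply/andP; split| |]; lra.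
move=> yh; rewrite lef_pV2 ?posrE//; last by lra.
have : (1 - x) / (1 - y) <= 2 by rewrite ler_pdivrMr; lra.
have : u / (1 - t) <= 2 by rewrite ler_pdivrMr; lra.
by rewrite /Q; lra.
Qed.

(** With q = lambda^2/2 one has ln eta = -q/v, and the exponent 1/v + beta_j - 1 of the weight
    equals beta_j + 1/r. *)
Lemma weight_ratio (eta : R) (j : int) : 0 < eta < 1 -> j != 0 ->
  weight r b eta j / weight r b eta 0 = cnorm r b eta / (1 - eta) *
    expR (- (2^-1 * lambda r eta ^+ 2 * (beta b `|j|%N + r^-1))).
Proof.
move=> eta01 j0; rewrite /weight (negbTE j0) eqxx lambda_sqr//.
have /andP[eta0 _] := eta01.
rewrite (powR_lnE _ v)// /powR gt_eqF ?expR_gt0// expRK.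
have {2}-> : eta = expR (ln eta) by rewrite lnK.
rewrite -(mulrA (cnorm _ _ _)) -expRD mulrAC; congr (_ * expR _).
have -> : r^-1 = v^-1 - 1 by rewrite vparV; ring.
by field; rewrite gt_eqF ?vpar_gt0.
Qed.

Lemma weight_ratio_ge0 (eta : R) (j : int) : 0 < eta < 1 -> j != 0 ->
  0 <= weight r b eta j / weight r b eta 0.
Proof.
move=> eta01 j0; rewrite weight_ratio// mulr_ge0 ?expR_ge0//.
have [/andP[c0 _] _] := cnorm_bounds _ eta01.
by rewrite divr_ge0 ?(ltW c0)// subr_ge0; case/andP: eta01 => _ /ltW.
Qed.

(* The threshold makes [lambda b >= 2] and [eta `^ (b ^+ 2 * v) <= 2^-1]. *)
Definition small_eta (eta : R) := 0 < eta /\ ln eta <= - (2 / (b ^+ 2 * v)).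

Lemma near_small_eta : \forall eta \near (0 : R)^'+, small_eta eta.
Proof.
near=> eta; have eta0 : 0 < eta by near: eta; exact: nbhs_right_gt.
split=> //; rewrite -[leRHS]expRK ler_ln ?posrE ?expR_gt0//.
by apply/ltW; near: eta; apply: nbhs_right_lt; exact: expR_gt0.
Unshelve. all: by end_near. Qed.

Lemma small_eta_bounds (eta : R) : small_eta eta ->
  [/\ 0 < eta < 1, 4 <= lambda r eta ^+ 2 * b ^+ 2, 1 <= lambda r eta
    & 8^-1 <= cnorm r b eta / (1 - eta) <= 1].
Proof.
move=> [eta0 lneta]; have v0 := vpar_gt0.
have b2 : 0 < b ^+ 2 by rewrite exprn_gt0.
have b2_le1 : b ^+ 2 <= 1 by rewrite expr_le1// ltW.
have v1 : v <= 1 by rewrite invf_le1// ?lerDl ?invr_ge0 ?addr_gt0 ?invr_gt0// ltW.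
have b2v : 0 < b ^+ 2 * v by rewrite mulr_gt0.
have lnb : ln eta * (b ^+ 2 * v) <= - 2 by rewrite -ler_pdivlMr// mulNr.
have b2v1 : b ^+ 2 * v <= 1 by nra.
have ln2 : ln eta <= - 2 by nra.
have halfE (x : R) : x <= - 2 -> expR x <= 2^-1.
  move=> x2; rewrite -[x]opprK expRN lef_pV2 ?posrE ?expR_gt0//.
  by apply: le_trans (expR_ge1Dx _); lra.
have etah : eta <= 2^-1 by rewrite -[leLHS]lnK ?posrE// halfE.
have eta01 : 0 < eta < 1 by rewrite eta0/=; lra.
have lam2 : 4 <= lambda r eta ^+ 2 * b ^+ 2 by rewrite lambda_sqr//; lra.
have lam0 : 0 <= lambda r eta by exact: sqrtr_ge0.
split => //; first by nra.
have [/andP[c0 c1] /(_ _) c8] := cnorm_bounds _ eta01.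
have {}c8 : 8^-1 <= cnorm r b eta by apply: c8; rewrite powR_lnE// halfE//; lra.
have e1 : 0 < 1 - eta by lra.
(* The upper bound uses c <= 1/2 <= 1 - eta, the lower one 1 - eta <= 1. *)
by rewrite ler_pdivlMr// ler_pdivrMr//; apply/andP; split; lra.
Qed.

(** * Nonnegativity of the logarithms, and the lower bound for N *)

Lemma Nterm_ge0 (eta theta z : R) (j : int) : 0 < eta < 1 -> j != 0 ->
  0 <= Nterm r b eta theta z j.
Proof. by move=> ? ?; rewrite mulr_ge0 ?expR_ge0 ?weight_ratio_ge0. Qed.

Lemma Dterm_ge0 (eta theta z : R) (j : int) : 0 < eta < 1 -> j != 0 ->
  0 <= Dterm r b eta theta z j.
Proof. by move=> ? ?; rewrite mulr_ge0 ?expR_ge0 ?weight_ratio_ge0. Qed.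

Lemma lne_Nfun_ge0 (eta theta z : R) : 0 < eta < 1 ->
  (0 <= lne (Nfun r b eta theta z))%E.
Proof.
move=> eta01; rewrite lne_ge0 /Nfun leeDl// esum_ge0// => j /= j0.
by rewrite lee_fin Nterm_ge0.
Qed.

Lemma lne_Dfun_ge0 (eta theta z : R) : 0 < eta < 1 ->
  (0 <= lne (Dfun r b eta theta z))%E.
Proof.
move=> eta01; rewrite lne_ge0 /Dfun leeDl// esum_ge0// => j /= j0.
by rewrite lee_fin Dterm_ge0.
Qed.

(** The kept index [n] is left free so as to serve for both l and l + 1; ln 8 pays for the factor
    c/(1 - eta) >= 1/8. *)
Lemma Elog_Nfun_ge_term (eta t : R) (n : nat) : small_eta eta -> (1 <= n)%N ->
  ((2^-1 * lambda r eta ^+ 2 *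
      (v^-1 * (2 * alpha b n * t - alpha b n ^+ 2) - beta b n - r^-1) - ln 8)%:E
    <= Elog (Nfun r b eta (lambda r eta * t)))%E.
Proof.
move=> sm n1; have [eta01 _ _ /andP[w8 _]] := small_eta_bounds _ sm.
have nz : Posz n != 0 by rewrite eqz_nat -lt0n.
set a := 2^-1 * _ * _; rewrite /Elog.
apply: (affine_le_integral_normal _ _ (lambda r eta * alpha b n / Num.sqrt v)).
  by move=> z; exact: lne_Nfun_ge0.
move=> z; set theta := _ * t.
apply: (@le_trans _ _ (lne (Nterm r b eta theta z n)%:E)); last first.
  rewrite lee_lne ?in_itv/= ?leey ?andbT ?lee_fin ?Nterm_ge0//; last first.
    by rewrite adde_ge0// esum_ge0// => j j0; rewrite lee_fin Nterm_ge0.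
  apply: le_trans (ler_esum_term [set j : int | j != 0]
    (fun j => (Nterm r b eta theta z j)%:E) (Posz n) nz) _.
  by rewrite /Nfun leeDr.
have w0 : 0 < cnorm r b eta / (1 - eta) by apply: lt_le_trans w8; rewrite invr_gt0.
rewrite /Nterm weight_ratio// -(mulrA (_ / _)) -expRD.
rewrite lne_EFin ?(mulr_gt0 w0) ?expR_gt0//.
rewrite lee_fin lnM ?posrE ?expR_gt0// expRK.
have : - ln 8 <= ln (cnorm r b eta / (1 - eta)).
  by rewrite -lnV ?posrE// ler_ln ?posrE ?invr_gt0.
have -> : atom r b eta n = lambda r eta * alpha b n.
  by rewrite /atom gtr0_sgz ?mul1r// ltz_nat.
rewrite /a /theta /=; set w := ln (_ / _); set V := v^-1; set q := Num.sqrt v.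
set i := r^-1; set A := alpha b n; set B := beta b n; set lam := lambda r eta.
move=> w8'; rewrite -[lam * A / q * z](mulrAC (lam * A) z q^-1).
set zz := lam * A * z / q.
suff : 2^-1 * lam ^+ 2 * (V * (2 * A * t - A ^+ 2) - B - i) =
  - (2^-1 * lam ^+ 2 * (B + i)) +
  V * (lam * A * (lam * t) - 2^-1 * (lam * A) ^+ 2) by lra.
by field.
Qed.

(** * The upper bound for D *)

Lemma young_le (z : R) (k : nat) (lam : R) : 0 <= lam -> 4 <= lam ^+ 2 * b ^+ 2 ->
  lam * k%:R * `|z| - 2^-1 * lam ^+ 2 * (b ^+ 2 * (k%:R * (k%:R - 1))) <=
  lam * `|z| + z ^+ 2 / b ^+ 2 + 1 - k%:R.
Proof.
move=> lam0 lamb; case: k => [|k].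
  have : 0 <= z ^+ 2 / b ^+ 2 by rewrite mulr_ge0 ?invr_ge0 ?sqr_ge0.
  by have := mulr_ge0 lam0 (normr_ge0 z); rewrite mulr0 !mul0r !mulr0; lra.
rewrite -natr1; have k0 := ler0n R k; set m : R := k%:R in k0 *.
(* With k = m + 1, this square bounds lambda m |z| by z^2/b^2 + P m^2/4, where P = lambda^2 b^2 >=
   4. The remaining decay P m^2/4 + P m/2 exceeds m = k - 1. *)
have := sqr_ge0 (`|z| / b - 2^-1 * lam * b * m).
rewrite -(real_normK (num_real z)); set y := `|z|.
have -> : (y / b - 2^-1 * lam * b * m) ^+ 2 =
  y ^+ 2 / b ^+ 2 - lam * m * y + 4^-1 * (lam ^+ 2 * b ^+ 2) * m ^+ 2.
  by field; rewrite gt_eqF.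
have : 4 * m <= lam ^+ 2 * b ^+ 2 * m by rewrite ler_wpM2r.
have : 0 <= lam ^+ 2 * b ^+ 2 * m ^+ 2 by rewrite -!exprMn sqr_ge0.
set P := lam ^+ 2 * b ^+ 2.
have -> : 2^-1 * lam ^+ 2 * (b ^+ 2 * ((m + 1) * (m + 1 - 1))) =
  2^-1 * (P * m ^+ 2) + 2^-1 * (P * m) by rewrite /P; field.
by lra.
Qed.

(** Exponent of the l-th term of D at theta = lambda t, plus the error of [young_le] that does not
    depend on j. *)
Definition peak_exponent (eta t z : R) (l : nat) : R :=
  lambda r eta * alpha b l * z
  + 2^-1 * lambda r eta ^+ 2 * (parabola b t l - r^-1)
  + lambda r eta * `|z| + z ^+ 2 / b ^+ 2 + 1.

(** Keeping theta <= lambda t separate from t lets t = 1 cover the whole range theta < lambda. *)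
Lemma Dterm_le (eta t theta z : R) (l : nat) (j : int) : small_eta eta ->
  alpha b l <= t -> t <= alpha b l.+1 -> 0 <= theta <= lambda r eta * t ->
  j != 0 ->
  Dterm r b eta theta z j <=
    expR (z ^+ 2 / 2) * expR (- (`|j|%N)%:R) +
    expR (peak_exponent eta t z l) * expR (- (`|j - l%:Z|%N)%:R).
Proof.
move=> sm lt tl /andP[th0 th1] j0.
have [eta01 lamb lam1 /andP[_ w1]] := small_eta_bounds _ sm.
have n1 : (1 <= `|j|)%N by rewrite absz_gt0.
set lam := lambda r eta in lamb lam1 th1 *.
have i0 : 0 < r^-1 by rewrite invr_gt0.
have a1 := alpha_ge1 b hb0 hb1 _ n1.
have /andP[bn _] := beta_bounds b hb0 hb1 _ n1.
rewrite /Dterm weight_ratio// -(mulrA (_ / _)) -[X in _ / _ * X]expRD.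
set E := expR (_ + _).
have wE : cnorm r b eta / (1 - eta) * E <= E by rewrite ger_pMl ?expR_gt0.
apply: le_trans wE _; rewrite {}/E -/lam.
have lam2 : 0 <= lam ^+ 2 by exact: sqr_ge0.
case/orP: (lt_total j0) => jlt.
(* Negative atoms: theta >= 0 only helps, completing the square leaves z^2/2, and the weight decays
   like e^(-|j|) because lambda^2 b^2 >= 4. *)
- apply: (@le_trans _ _ (expR (z ^+ 2 / 2) * expR (- (`|j|%N)%:R))); last first.
    by rewrite lerDl mulr_ge0 ?expR_ge0.
  rewrite -expRD ler_expR /atom ltr0_sgz// mulN1r -/lam.
  set n := `|j|%N in n1 a1 bn *; set N : R := n%:R in bn *.
  have : lam ^+ 2 * (b ^+ 2 * N) <= lam ^+ 2 * (beta b n + r^-1).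
    by rewrite ler_wpM2l//; lra.
  have : 4 * N <= lam ^+ 2 * b ^+ 2 * N by rewrite ler_wpM2r.
  have : 0 <= lam * alpha b n * theta by rewrite !mulr_ge0//; lra.
  have : 0 <= N by rewrite ler0n.
  by have := sqr_ge0 (lam * alpha b n + z); nra.
(* Positive atoms: the term increases with theta, so theta may be raised to lambda t;
   [parabola_peak] and [young_le] then compare index n with l. *)
- have [n jn] : exists n, j = Posz n.
    by case: j j0 jlt {n1 a1 bn} => // n _ _; exists n.
  rewrite {j}jn in j0 n1 a1 bn jlt *; rewrite /= in n1 a1 bn *.
  apply: (@le_trans _ _ (expR (peak_exponent eta t z l) *
      expR (- (`|Posz n - l%:Z|%N)%:R))); last first.
    by rewrite lerDr mulr_ge0 ?expR_ge0.
  have [peak agap] := parabola_peak b hb0 hb1 _ _ n lt tl.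
  rewrite -expRD ler_expR /atom gtr0_sgz// mul1r /peak_exponent -/lam.
  have Y := young_le z `|n%:Z - l%:Z|%N _ _ lamb.
  move: peak agap Y; set k : R := (`|_|%N)%:R => peak agap /(_ ltac:(lra)) Y.
  have H1 : lam * (alpha b n - alpha b l) * z <= lam * k * `|z|.
    rewrite -!mulrA ler_wpM2l//; first by lra.
    apply: le_trans (ler_norm _) _; rewrite normrM ler_wpM2r//.
  have H2 : lam * alpha b n * theta <= lam * alpha b n * (lam * t).
    by rewrite ler_wpM2l// mulr_ge0; lra.
  have H3 : 2^-1 * lam ^+ 2 * parabola b t n <=
      2^-1 * lam ^+ 2 * (parabola b t l - b ^+ 2 * (k * (k - 1))).
    by rewrite ler_wpM2l// mulr_ge0.
  have E : 2^-1 * lam ^+ 2 * parabola b t n = lam * alpha b n * (lam * t)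
     - 2^-1 * (lam * alpha b n) ^+ 2 - 2^-1 * lam ^+ 2 * beta b n.
    by rewrite /parabola; field.
  move: H1 H2 H3 E Y; rewrite !mulrBr !mulrDr.
  by lra.
Qed.

(** For bounded slope take p = 0 and s z <= S (1 + z^2). Otherwise take p = s: the quadratic m + s z
    + 4 z^2 has discriminant s^2 - 16 m <= 0. The size of [p] is irrelevant after integration. *)
Lemma relu_linearize (s m S : R) : 0 <= S -> 0 <= s <= S \/ s ^+ 2 <= 16 * m ->
  exists p, forall z, Num.max 0 (s * z + m) <=
    Num.max m 0 + p * z + S * (1 + z ^+ 2) + 4 * z ^+ 2.
Proof.
move=> S0 [/andP[s0 sS]|sm].
- exists 0 => z; have z2 := sqr_ge0 z.
  have m0 : 0 <= Num.max m 0 by rewrite le_max lexx orbT.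
  have mm : m <= Num.max m 0 by rewrite le_max lexx.
  have Sz : 0 <= S * (1 + z ^+ 2) by rewrite mulr_ge0//; lra.
  rewrite mul0r addr0 ge_max; apply/andP; split; first lra.
  have : s * z <= S * (1 + z ^+ 2).
    apply: (@le_trans _ _ (s * (1 + z ^+ 2))); last by rewrite ler_wpM2r//; lra.
    by rewrite ler_wpM2l//; have := sqr_ge0 (z - 1); nra.
  by lra.
- have m0 : 0 <= m by have := sqr_ge0 s; lra.
  exists s => z; have z2 := sqr_ge0 z; rewrite (max_idPl m0).
  have Sz : 0 <= S * (1 + z ^+ 2) by rewrite mulr_ge0//; lra.
  rewrite ge_max; apply/andP; split; last lra.
  by have := sqr_ge0 (s + 8 * z); nra.
Qed.

(** Threshold on alpha_l: above it, (1 + 1/r) alpha_l <= alpha_l^2/2, so parabola - 1/r >=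
    alpha_l^2/2 and the slope satisfies s^2 <= 16 m. *)
Let A : R := 2 + 2 / r.

Lemma Elog_Dfun_le : exists C, forall (eta t theta : R) (l : nat), small_eta eta ->
  (1 <= l)%N -> alpha b l <= t -> t <= alpha b l.+1 ->
  0 <= theta <= lambda r eta * t ->
  (Elog (Dfun r b eta theta) <=
    (2^-1 * lambda r eta ^+ 2 * Num.max (parabola b t l - r^-1) 0
     + C * lambda r eta)%:E)%E.
Proof.
pose M : R := second_moment_bound; exists (10 + 1 + A + (b ^- 2 + 1 + A + 4) * M).
move=> eta t theta l sm l1 lt tl th.
have [eta01 lamb lam1 _] := small_eta_bounds _ sm.
set lam := lambda r eta in lamb lam1 th *.
set m := 2^-1 * lam ^+ 2 * (parabola b t l - r^-1).
have i0 : 0 < r^-1 by rewrite invr_gt0.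
have A0 : 0 <= A by rewrite /A; lra.
have lamA : 0 <= A * lam by rewrite mulr_ge0//; lra.
have a1 := alpha_ge1 b hb0 hb1 _ l1.
have /andP[_ ba] := beta_bounds b hb0 hb1 _ l1.
have [] := relu_linearize (lam * alpha b l) m (A * lam) lamA.
  have [aA|Aa] := leP (alpha b l) A.
    left; rewrite mulr_ge0 ?(mulrC A) ?ler_wpM2l//; lra.
  right; rewrite /m exprMn.
  have -> (d : R) : 16 * (2^-1 * lam ^+ 2 * d) = lam ^+ 2 * (8 * d) by field.
  rewrite ler_wpM2l ?sqr_ge0// /parabola.
  have : A * alpha b l <= alpha b l ^+ 2 by rewrite expr2 ler_wpM2r; lra.
  have : r^-1 <= r^-1 * alpha b l by rewrite ler_peMr// ltW.
  have : alpha b l ^+ 2 <= alpha b l * t by rewrite expr2 ler_wpM2l//; lra.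
  by rewrite /A; nra.
move=> p Hp.
(* Coefficients of the final quadratic: 10 is 9 (a bound for ln 9) plus the 1 in [W]; lambda comes
   from lambda |z| <= lambda (1 + z^2), and A lambda and 4 from [relu_linearize]. *)
pose a : R := 10 + lam + A * lam + Num.max m 0.
pose c : R := b ^- 2 + lam + A * lam + 4.
have b20 : 0 < b ^- 2 by rewrite invr_gt0 exprn_gt0.
have b21 : 1 <= b ^- 2 by rewrite invf_ge1 ?exprn_gt0// expr_le1// ltW.
apply: le_trans (integral_normal_le_quadratic _ a p c _ _ _) _.
- by rewrite /c; lra.
- by move=> z; exact: lne_Dfun_ge0.
- move=> z.
  have /(@leeD2l _ 1%E) HD := esum_int_le [set j : int | j != 0] _ _ _ l
    (expR_ge0 (z ^+ 2 / 2)) (expR_ge0 (peak_exponent eta t z l))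
    (fun j j0 => Dterm_le eta t theta z l j sm lt tl th j0).
  set X := 4 * _ + 4 * _ in HD.
  have X0 : 0 <= X by rewrite addr_ge0 ?mulr_ge0 ?expR_ge0.
  apply: (@le_trans _ _ (lne (1 + X)%:E)).
    rewrite lee_lne ?in_itv/= ?leey ?andbT//.
      by rewrite adde_ge0// esum_ge0// => j j0; rewrite lee_fin Dterm_ge0.
    by rewrite lee_fin addr_ge0.
  rewrite lne_EFin ?ltr_wpDr// lee_fin.
  pose W := z ^+ 2 / b ^+ 2 + lam * `|z| + 1 + Num.max 0 (lam * alpha b l * z + m).
  have zz := sqr_ge0 z; have lz : 0 <= lam * `|z| by rewrite mulr_ge0//; lra.
  have zb : z ^+ 2 <= z ^+ 2 / b ^+ 2 by rewrite ler_peMr.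
  have mx0 : 0 <= Num.max 0 (lam * alpha b l * z + m) by rewrite le_max lexx.
  have mx1 : lam * alpha b l * z + m <= Num.max 0 (lam * alpha b l * z + m).
    by rewrite le_max lexx orbT.
  (* [W] dominates 0 and both exponents, whence 9 = 1 + 4 + 4. *)
  have XW : 1 + X <= 9 * expR W.
    have : 1 <= expR W by rewrite -expR0 ler_expR /W; lra.
    have : expR (z ^+ 2 / 2) <= expR W by rewrite ler_expR /W; lra.
    have : expR (peak_exponent eta t z l) <= expR W.
      by rewrite ler_expR /peak_exponent -/lam -/m /W; lra.
    by rewrite /X; lra.
  apply: (@le_trans _ _ (9 + W)).
    apply: (@le_trans _ _ (ln (9 * expR W))).
      by rewrite ler_ln ?posrE ?mulr_gt0 ?expR_gt0 ?ltr_wpDr.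
    by rewrite lnM ?posrE ?expR_gt0// expRK lerD2r ltW// ln_sublinear.
  have zlam : lam * `|z| <= lam * (1 + z ^+ 2).
    rewrite ler_wpM2l//; first by lra.
    by have := sqr_ge0 (`|z| - 1); rewrite sqrrB -normrX (ger0_norm zz); lra.
  by have := Hp z; rewrite /W /a /c; lra.
rewrite lee_fin.
have -> : 2^-1 * lam ^+ 2 * Num.max (parabola b t l - r^-1) 0 = Num.max m 0.
  by rewrite maxr_pMr ?mulr0// mulr_ge0 ?sqr_ge0.
have M0 : 0 <= M by rewrite /M /second_moment_bound mulr_ge0 ?expR_ge0.
have : a <= Num.max m 0 + (10 + 1 + A) * lam by rewrite /a; lra.
have : c * M <= (b ^- 2 + 1 + A + 4) * lam * M.
  by rewrite ler_wpM2r// /c; nra.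
by rewrite -/M; lra.
Qed.

End Prior.

(** * Assembly of the four bounds *)

Theorem lemma2p2 (R : realType) (r b : R) (hr : 0 < r) (hb0 : 0 < b)
    (hb1 : b <= 1) :
  [/\ exists C : R, \forall eta \near (0 : R)^'+,
        forall (l : nat) (omega theta : R),
          (1 <= l)%N -> 0 <= omega < dalpha b l ->
          theta = lambda r eta * (alpha b l + omega) ->
          ((2^-1 * lambda r eta ^+ 2
              * Num.max (nexp r b l omega) (ncheck r b l omega) - C)%:E
            <= Elog (Nfun r b eta theta))%E,
      exists C : R, \forall eta \near (0 : R)^'+,
        forall (l : nat) (omega theta : R),
          (1 <= l)%N -> 0 <= omega < dalpha b l ->
          theta = lambda r eta * (alpha b l + omega) ->
          (Elog (Dfun r b eta theta)
            <= (2^-1 * lambda r eta ^+ 2 * Num.max (dexp r b l omega) 0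
                + C * lambda r eta)%:E)%E,
      forall eta theta : R, 0 < eta < 1 -> 0 <= theta < lambda r eta ->
        (0 <= Elog (Nfun r b eta theta))%E
    & exists C : R, \forall eta \near (0 : R)^'+,
        forall theta : R, 0 <= theta < lambda r eta ->
          (Elog (Dfun r b eta theta) <= (C * lambda r eta)%:E)%E].
Proof.
have [CD HD] := Elog_Dfun_le r b hr hb0 hb1.
have step l (omega : R) : 0 <= omega < dalpha b l ->
    alpha b l <= alpha b l + omega <= alpha b l.+1.
  by rewrite /dalpha => /andP[? ?]; apply/andP; split; lra.
split.
- exists (ln 8); apply: filterS (near_small_eta r b).
  move=> eta sm l omega theta l1 om ->.
  have Hl := Elog_Nfun_ge_term r b hr hb0 hb1 _ (alpha b l + omega) _ sm l1.
  have Hl1 := Elog_Nfun_ge_term r b hr hb0 hb1 _ (alpha b l + omega) _ sm (ltn0Sn l).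
  have [_|_] := leP (nexp r b l omega) (ncheck r b l omega).
    (* [ncheck] is exactly the exponent of the term l + 1, once alpha and beta are advanced by d and
       d^2. *)
    apply: le_trans Hl1; rewrite lee_fin lerD2r le_eqVlt; apply/orP; left.
    apply/eqP; congr (_ * _).
    have -> : beta b l.+1 = beta b l + dalpha b l ^+ 2.
      by rewrite -(dbetaE b l); ring.
    have -> : alpha b l.+1 = alpha b l + dalpha b l by rewrite /dalpha; ring.
    by rewrite /ncheck /nexp; ring.
  apply: le_trans Hl; rewrite lee_fin lerD2r le_eqVlt; apply/orP; left.
  by apply/eqP; congr (_ * _); rewrite /nexp; ring.
- exists CD; apply: filterS (near_small_eta r b) => eta sm l omega theta l1 om ->.
  have [_ _ lam1 _] := small_eta_bounds r b hr hb0 hb1 _ sm.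
  have /andP[lt tl] := step _ _ om.
  have -> : dexp r b l omega = parabola b (alpha b l + omega) l - r^-1.
    by rewrite /dexp /parabola; ring.
  apply: HD => //; rewrite lexx andbT.
  by have := alpha_ge1 b hb0 hb1 _ l1; move=> ?; rewrite mulr_ge0; lra.
- move=> eta theta eta01 _; rewrite /Elog integral_ge0// => z _.
  exact: lne_Nfun_ge0.
- exists CD; apply: filterS (near_small_eta r b) => eta sm theta /andP[th0 th1].
  have a12 : alpha b 1 <= alpha b 2.
    have /andP[? _] := dalpha_bounds b hb1 1.
    by rewrite -subr_ge0 -/(dalpha b 1); lra.
  have th : 0 <= theta <= lambda r eta * alpha b 1.
    by rewrite alpha1 mulr1 th0 ltW.
  (* At l = 1 and t = alpha_1 = 1 the parabola vanishes, so the maximum of -1/r and 0 is 0. *)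
  apply: le_trans (HD _ _ _ 1%N sm isT (lexx _) a12 th) _.
  rewrite lee_fin gerDr /parabola alpha1 beta1.
  rewrite (_ : Num.max _ 0 = 0) ?mulr0//; apply/max_idPr.
  by have : 0 < r^-1; [rewrite invr_gt0 | lra].
Qed.
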